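(* Suppose the torsion free group $G$ acts properly, preserving factors, on a product $P=T_1\times\cdots\times T_k$ of $k$ locally finite trees, and that $G$ does not contain $\mathbb{Z}\times\mathbb{Z}$. Then for each non-identity element $g\in G$ there is an action of $G$ on some locally finite tree $T$ (depending on $g$) which is minimal, faithful and such that $g$ acts hyperbolically.
   Context: Trees are simplicial trees with the path metric; actions on trees are by simplicial automorphisms; locally finite means every vertex has finite degree. $G$ acts on $P$ preserving factors if the action is given by a homomorphism $G\to\mathrm{Aut}(T_1)\times\cdots\times\mathrm{Aut}(T_k)$. The action is proper if the stabiliser of every vertex of $P$ is finite. An automorphism of a tree is elliptic if it fixes a point of the tree and hyperbolic otherwise (it then translates along an axis). An action on a tree is minimal if there is no proper non-empty invariant subtree. *)

(* Defs.v *)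
From HB Require Import structures.
From mathcomp Require Import all_boot all_order all_algebra.
From mathcomp Require Import classical_sets cardinality reals.

Set Implicit Arguments.
Unset Strict Implicit.
Unset Printing Implicit Defensive.

Import Order.TTheory GRing.Theory Num.Theory.

Local Open Scope classical_set_scope.

Record graph := Graph {
  vertex :> eqType;
  adj : rel vertex;
  adj_sym : symmetric adj;
  adj_irr : irreflexive adj }.

(* The size bound discards the degenerate cycle [:: x; y] running back and
   forth along one edge. *)
Record is_tree (T : graph) : Prop := IsTree {
  tree_inhabited : inhabited T;
  tree_connected :
    forall x y : T, exists2 p : seq T, path (@adj T) x p & last x p = y;
  tree_acyclic :
    forall c : seq T, ucycle (@adj T) c -> (size c < 3)%N }.

Record tree := Tree {
  tree_graph :> graph;
  treeP : is_tree tree_graph }.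

Definition locally_finite (T : tree) : Prop :=
  forall x : T, finite_set [set y : T | adj x y].

(* A left action by simplicial automorphisms, that is, a homomorphism from G
   to Aut(T). *)
Record tree_action (G : groupType) (T : tree) := TreeAction {
  act :> G -> T -> T;
  act1 : forall x, act 1%g x = x;
  actM : forall g h x, act (g * h)%g x = act g (act h x);
  act_adj : forall g x y, adj (act g x) (act g y) = adj x y }.

(* The barycentric coordinates of the point at parameter t on the segment from
   x to y. *)
Definition segment_point (R : realType) (T : tree) (x y : T) (t : R) : T -> R :=
  fun v => ((1 - t) * (v == x)%:R + t * (v == y)%:R)%R.

(* The fixed point may lie anywhere in the geometric realisation of T, so that
   an inversion of an edge is elliptic: it fixes the midpoint.  The case x = y
   covers the vertices. *)
Definition elliptic (R : realType) (T : tree) (f : T -> T) : Prop :=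
  exists (x y : T) (t : R),
    [/\ x = y \/ adj x y, (0 <= t <= 1)%R
      & segment_point (f x) (f y) t =1 segment_point x y t].

Definition hyperbolic (R : realType) (T : tree) (f : T -> T) : Prop :=
  ~ elliptic R f.

(* A connected subgraph of a tree contains every edge joining two of its
   vertices, so a subtree is given by its vertex set. *)
Definition subtree (T : tree) (S : set T) : Prop :=
  forall x y : T, S x -> S y ->
    exists p : seq T,
      [/\ path (@adj T) x p, last x p = y & forall z, z \in p -> S z].

Definition invariant (G : groupType) (T : tree) (a : tree_action G T)
    (S : set T) : Prop :=
  forall g : G, a g @` S = S.

Definition minimal_action (G : groupType) (T : tree) (a : tree_action G T)
    : Prop :=
  ~ exists S : set T, [/\ subtree S, S !=set0, S `<` setT & invariant a S].

Definition faithful_action (G : groupType) (T : tree) (a : tree_action G T)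
    : Prop :=
  forall g : G, (forall x : T, a g x = x) -> g = 1%g.

Definition prod_vertex (k : nat) (T : 'I_k -> tree) := forall i, T i.

(* A factor-preserving action on the product is a family of actions, one on
   each factor. *)
Definition prod_act (G : groupType) (k : nat) (T : 'I_k -> tree)
    (a : forall i, tree_action G (T i)) (g : G) (x : prod_vertex T)
    : prod_vertex T :=
  fun i => a i g (x i).

Definition proper_action (G : groupType) (k : nat) (T : 'I_k -> tree)
    (a : forall i, tree_action G (T i)) : Prop :=
  forall x : prod_vertex T, finite_set [set g : G | prod_act a g x = x].

Definition torsion_free (G : groupType) : Prop :=
  forall (g : G) (n : nat), (0 < n)%N -> (g ^+ n)%g = 1%g -> g = 1%g.

Definition contains_ZxZ (G : groupType) : Prop :=
  exists2 f : int * int -> G,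
    injective f & forall u v, f (u + v)%R = (f u * f v)%g.

(* Main.v *)
(* Shrink the set of factors to a minimal subset J on which G still acts
   properly.  As G is torsion free, an element whose square fixes a vertex of
   each factor in J is trivial, so g has no fixed vertex and no inverted edge on
   T_i for some i in J.  A vertex of T_i least displaced by g lies in every
   non-empty invariant subtree, so the intersection U of these subtrees is
   non-empty, and it is minimal.
   If n acts trivially on U, pick by minimality of J some h <> 1 fixing vertices
   x_j for all j in J other than i.  By local finiteness a power h^m also fixes
   the vertices n x_j, so [n, h^m] fixes all the x_j as well as U, and is
   trivial.  Then n and h^m generate Z x Z unless n = 1. *)
Require Import Defs.
From HB Require Import structures.
From mathcomp Require Import all_boot all_order all_algebra.
From mathcomp Require Import lra.
From mathcomp Require Import boolp classical_sets cardinality reals.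

Set Implicit Arguments.
Unset Strict Implicit.
Unset Printing Implicit Defensive.

Import Order.TTheory GRing.Theory Num.Theory.

Local Open Scope classical_set_scope.

Lemma finite_pigeonhole (T : Type) (A : set T) (f : nat -> T) :
  finite_set A -> (forall n, A (f n)) -> exists m n, (m < n)%N /\ f m = f n.
Proof.
move=> finA fA; apply: contrapT => f_neq; apply: infinite_nat.
have -> : [set: nat] = f @^-1` A by apply/seteqP; split=> // n _; exact: fA.
apply: finite_preimage finA => m n _ _ fE.
by have [mn|nm|//] := ltngtP m n; case: f_neq; [exists m, n|exists n, m].
Qed.

(** * Walks without backtracking *)

Section Reduced.
Variable V : eqType.

(** Entries two apart differ: the walk never turns straight back along an edge. *)
Fixpoint reduced (s : seq V) :=
  if s is x :: s' then
    (if s' is _ :: z :: _ then x != z else true) && reduced s'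
  else true.

(** The condition involves three consecutive entries, so pieces that overlap in two entries glue. *)
Lemma reduced_cat2 (s1 s2 : seq V) x y :
  reduced (s1 ++ [:: x; y]) -> reduced (x :: y :: s2) ->
  reduced (s1 ++ [:: x, y & s2]).
Proof.
elim: s1 => [//|z s1 IHs] /= /andP[zP s1P] s2P; rewrite IHs // andbT.
by case: s1 {IHs s1P} zP => [|? [|? ?]].
Qed.

Lemma reduced_join (s1 s2 : seq V) x y z :
  reduced (s1 ++ [:: x; y]) -> x != z -> reduced (y :: z :: s2) ->
  reduced (s1 ++ [:: x, y, z & s2]).
Proof. by move=> s1P xz s2P; apply: reduced_cat2 => //=; rewrite xz. Qed.

Lemma reduced_rev (s : seq V) : reduced s -> reduced (rev s).
Proof.
elim: s => [//|x [//|y [//|z s]] IHs] /= /andP[xz].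
move=> /IHs; rewrite !rev_cons -!cats1 -!catA => /= sP.
by apply: reduced_join; rewrite ?(eq_sym z).
Qed.

Lemma reduced_uniq (s : seq V) : uniq s -> reduced s.
Proof.
elim: s => [//|x s IHs] /= /andP[xs /IHs ->]; rewrite andbT.
by case: s {IHs} xs => [|y [|z s]] //; rewrite !inE !negb_or => /and3P[].
Qed.

End Reduced.

(** * Geodesics in trees *)

Section Trees.
Variable T : tree.
Implicit Types (x y z : T) (p q s : seq T) (S : set T).

Lemma sorted_adj_rev s : sorted (@adj T) (rev s) = sorted (@adj T) s.
Proof. by rewrite rev_sorted; apply: eq_sorted => x y; rewrite adj_sym. Qed.

(** By induction the tail has no repetition, so a return to the head [x] closes a simple cycle
    [x :: p1]. Acyclicity leaves [p1] with at most one vertex: a loop or a backtrack, both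
    excluded. *)
Lemma tree_reduced_uniq s : sorted (@adj T) s -> reduced s -> uniq s.
Proof.
elim: s => [//|x p IHp] xp /= /andP[hd redp].
have pU : uniq p by apply: IHp redp; exact: path_sorted xp.
rewrite pU andbT; apply/negP => x_in_p.
case/splitPr: x_in_p xp hd pU {IHp redp} => p1 p2 /= xp hd pU.
have /(tree_acyclic (treeP T)) : ucycle (@adj T) (x :: p1).
  apply/andP; split.
    by move: xp; rewrite -cat_rcons cat_path => /andP[].
  by move: pU; rewrite -cat_rcons cat_uniq rcons_uniq => /andP[].
case: p1 xp hd {pU} => [|y [|z p1]] //=; first by rewrite adj_irr.
by rewrite eqxx.
Qed.

(** Where the paths diverge, one of them reversed and followed by the other is reduced, hence free
    of repetitions, which contradicts their common endpoint. *)
Lemma tree_uniq_path x p q :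
  path (@adj T) x p -> path (@adj T) x q -> uniq (x :: p) -> uniq (x :: q) ->
  last x p = last x q -> p = q.
Proof.
elim: p x q => [|y p IHp] x [|z q] //.
- by move=> _ _ _ /andP[+ _] xE; rewrite [x in x \notin _]xE /= mem_last.
- by move=> _ _ /andP[+ _] _ /esym xE; rewrite [x in x \notin _]xE /= mem_last.
move=> xyp xzq xypU xzqU lE.
have [yz|yz] := eqVneq y z.
  move: xyp xzq xypU xzqU lE; rewrite -{}yz => /andP[_ yp] /andP[_ yq].
  by move=> /andP[_ ypU] /andP[_ yqU] /(IHp _ _ yp yq ypU yqU)->.
have : uniq (rev (y :: p) ++ x :: z :: q).
  apply: tree_reduced_uniq.
    by rewrite sorted_cat_cons -rev_cons sorted_adj_rev; apply/andP.
  rewrite rev_cons -cats1 -catA; apply: reduced_join => //.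
    by have := reduced_rev (reduced_uniq xypU); rewrite !rev_cons -!cats1 -catA.
  exact: reduced_uniq.
rewrite cat_uniq => /and3P[_ /hasPn/(_ (last x (z :: q)) (mem_last x _)) + _].
by rewrite -lE mem_rev /= mem_last.
Qed.

Lemma tree_geodesic x y :
  exists p, [/\ path (@adj T) x p, last x p = y & uniq (x :: p)].
Proof.
have [p xp <-] := tree_connected (treeP T) x y.
by case/shortenP: xp => q xq qU _; exists q.
Qed.

Lemma subtree_geodesic S x p : subtree S -> S x -> path (@adj T) x p ->
  uniq (x :: p) -> S (last x p) -> forall z, z \in x :: p -> S z.
Proof.
move=> S_sub Sx xp xpU Sl.
have [q [xq lE qS]] := S_sub _ _ Sx Sl.
case/shortenP: xq lE => r xr rU rq lE.
rewrite (tree_uniq_path xp xr xpU rU (esym lE)).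
by move=> z; rewrite inE => /predU1P[->//|/rq/qS].
Qed.

(** A geodesic towards [y] is cut at its first vertex in [S]. *)
Lemma path_to_subset S x y : ~ S x -> S y -> exists p z,
  [/\ path (@adj T) x (rcons p z), uniq (x :: rcons p z), S z
    & forall u, u \in x :: p -> ~ S u].
Proof.
move=> nSx Sy; have [p [xp lE pU]] := tree_geodesic x y.
have : has (fun z => `[< S z >]) p.
  case/lastP: p lE {xp pU} => [xE|p z]; first by case: nSx; rewrite [x]xE.
  by rewrite last_rcons => ->; rewrite has_rcons; apply/orP; left; apply/asboolP.
move=> /split_find pE; case: pE xp pU => z p1 p2 /asboolP Sz p1S.
rewrite cat_path -cat_cons cat_uniq => /andP[xp _] /andP[pU _].
exists p1, z; split=> // u; rewrite inE => /predU1P[->//|up1] Su.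
by move/hasPn/(_ u up1): p1S => /asboolP.
Qed.

Lemma tree_shortest_geodesic x p q :
  path (@adj T) x p -> path (@adj T) x q -> last x p = last x q ->
  uniq (x :: q) -> (size q <= size p)%N.
Proof.
move=> xp xq; case/shortenP: xp => r xr rU rp lE qU.
by rewrite -(tree_uniq_path xr xq rU qU lE) uniq_leq_size //; case/andP: rU.
Qed.

End Trees.

(** * Tree actions and the smallest invariant subtree *)

Section Actions.
Variables (G : groupType) (T : tree) (a : tree_action G T).
Implicit Types (g h : G) (x y z : T) (S : set T).

Lemma actK g : cancel (a g) (a g^-1%g).
Proof. by move=> x; rewrite -actM mulVg act1. Qed.

Lemma act_inj g : injective (a g).
Proof. exact: can_inj (actK g). Qed.

Lemma act_invP g x y : a g^-1%g x = y <-> x = a g y.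
Proof.
by split=> [<-|->]; rewrite ?actK // -actM mulgV act1.
Qed.

Lemma map_act_path g x p : path (@adj T) (a g x) (map (a g) p) = path (@adj T) x p.
Proof.
by elim: p x => //= y p IHp x; rewrite IHp act_adj.
Qed.

Lemma fix_expg g x n : a g x = x -> a (g ^+ n)%g x = x.
Proof. by move=> gx; elim: n => [|n IHn]; rewrite ?act1 // expgS actM IHn. Qed.

Lemma fix_invg g x : a g x = x -> a g^-1%g x = x.
Proof. by move=> gx; apply/act_invP. Qed.

Lemma invariantP S : Defs.invariant a S <-> forall g x, S x -> S (a g x).
Proof.
split=> [Sa g x Sx|Sa g]; first by rewrite -(Sa g); exists x.
apply/seteqP; split=> [_ [x Sx <-]|x Sx]; first exact: Sa.
by exists (a g^-1%g x); [exact: Sa|rewrite -actM mulgV act1].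
Qed.

Lemma invariant_act S g x : Defs.invariant a S -> S (a g x) -> S x.
Proof. by move=> /invariantP Sa /(Sa g^-1%g); rewrite actK. Qed.

(* If x is not in S, a geodesic from x to its gate s in S, one from s to [g s]
   within S, and the reversed image of the first form a reduced walk from x to
   [g x], hence the geodesic, which is longer than the displacement of s. *)
Lemma min_displacement_mem S g x p :
    subtree S -> S !=set0 -> Defs.invariant a S -> (forall y, a g y <> y) ->
    path (@adj T) x p -> last x p = a g x ->
    (forall y q, path (@adj T) y q -> last y q = a g y -> (size p <= size q)%N) ->
  S x.
Proof.
move=> S_sub [y0 Sy0] Sinv gfix xp lp p_min; apply: contrapT => nSx.
have [q [s [xq qU Ss qS]]] := path_to_subset nSx Sy0.
have Sgs : S (a g s) by move/invariantP: Sinv; apply.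
have [r [sr lr rU]] := tree_geodesic s (a g s).
have rS : forall z, z \in s :: r -> S z.
  by apply: subtree_geodesic => //; rewrite lr.
suff [wP wU] : path (@adj T) x (q ++ s :: r ++ map (a g) (rev (x :: q))) /\
    uniq (x :: q ++ s :: r ++ map (a g) (rev (x :: q))).
  have := tree_shortest_geodesic xp wP _ wU.
  rewrite lp last_cat /= last_cat rev_cons map_rcons last_rcons => /(_ erefl).
  have := p_min _ _ sr lr.
  rewrite !(size_cat, size_rcons, size_map, size_rev) /= => pr.
  rewrite !(size_cat, size_rcons, size_map, size_rev) /= => /leq_trans/(_ pr).
  by rewrite addnS ltnNge (leq_trans (leq_addr _ _) (leq_addl _ _)).
have wP : path (@adj T) x (q ++ s :: r ++ map (a g) (rev (x :: q))).
  rewrite -cat_rcons !cat_path xq last_rcons sr lr /=.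
  have : sorted (@adj T) (map (a g) (rev (x :: rcons q s))).
    rewrite map_rev sorted_adj_rev /= map_act_path //.
  by rewrite -rcons_cons rev_rcons.
split=> //; apply: tree_reduced_uniq => //.
case/lastP: r lr rU rS sr {wP} => [sE|r z]; first by case: (gfix s).
rewrite last_rcons => -> {z} rU rS sr.
(* No backtracking at [s]: the vertex before it is outside [S], the vertex [t] after it is in
   [S]. *)
have red1 : reduced ((x :: q) ++ s :: rcons r (a g s)).
  have := reduced_uniq qU; rewrite -rcons_cons; have := reduced_uniq rU.
  have [t [r0 rE]] : exists t r0, rcons r (a g s) = t :: r0.
    case: r {rU rS sr} => [|t r0]; first by exists (a g s), [::].
    by exists t, (rcons r0 (a g s)).
  have St : S t by apply: rS; rewrite rE !inE eqxx orbT.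
  case/lastP E : (x :: q) qS => [//|q' u] qS; rewrite rE => red_r red_q.
  rewrite cat_rcons; apply: reduced_join red_r.
    by rewrite -!cats1 -catA in red_q.
  by apply/eqP => ut; apply: (qS u); rewrite ?mem_rcons ?mem_head // ut.
have red2 : reduced (a g s :: map (a g) (rev (x :: q))).
  rewrite -map_cons -rev_rcons; apply: reduced_uniq.
  by rewrite map_inj_uniq ?rev_uniq //; exact: act_inj.
(* No backtracking at [a g s]: the vertex [t] before it is in [S], while the next one is [a g u]
   with [u] outside [S], so it is outside [S] by invariance. *)
have [t [r0 rE]] : exists t r0, s :: r = rcons r0 t.
  by exists (last s r), (belast s r); rewrite -lastI.
have St : S t by apply: rS; rewrite -rcons_cons rE -cats1 mem_cat mem_rcons mem_head.
have rE' : s :: rcons r (a g s) = r0 ++ [:: t; a g s].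
  by rewrite -rcons_cons rE -!cats1 -catA.
move: red1; rewrite -(cat_cons s) -(cat_cons x) rE' -!catA !(catA (x :: q) r0).
case/lastP E : (x :: q) qS red2 => [//|q' u] qS; rewrite rev_rcons => red2 red1.
apply: reduced_join => //; apply/eqP => tE; apply: (qS u).
  by rewrite mem_rcons mem_head.
by apply: (invariant_act (g := g)) => //; rewrite -tE.
Qed.

Definition core : set T :=
  [set x | forall S, subtree S -> S !=set0 -> Defs.invariant a S -> S x].

Lemma core_subtree : subtree core.
Proof.
move=> x y Cx Cy; have [p [xp lp pU]] := tree_geodesic x y.
exists p; split=> // z zp S S_sub S0 Sinv.
apply: (subtree_geodesic S_sub (Cx S S_sub S0 Sinv) xp pU).
  by rewrite lp; exact: Cy.
by rewrite inE zp orbT.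
Qed.

Lemma core_act g x : core x -> core (a g x).
Proof.
by move=> Cx S S_sub S0 Sinv; move/invariantP: (Sinv); apply; exact: Cx.
Qed.

Lemma core_neq0 g : (forall x, a g x <> x) -> core !=set0.
Proof.
move=> gfix; have [x0] := tree_inhabited (treeP T).
(* The minimum is over all vertices and all walks to their images, so no distance function is
   required. *)
pose P n := `[< exists x p,
  [/\ path (@adj T) x p, last x p = a g x & size p = n] >].
have exP : exists n, P n.
  have [p x0p lp] := tree_connected (treeP T) x0 (a g x0).
  by exists (size p); apply/asboolP; exists x0, p.
have [n /asboolP[x [p [xp lp <-]]] n_min] := ex_minnP exP.
exists x => S S_sub S0 Sinv.
apply: (min_displacement_mem S_sub S0 Sinv gfix xp lp) => y q yq lq.
by apply: n_min; apply/asboolP; exists y, q.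
Qed.

(** Induction along a walk from [x] to [y]: an element fixing a vertex permutes its finitely many
    neighbours, so some power fixes the next vertex of the walk. *)
Lemma fix_expg_locally_finite g x y : locally_finite T -> a g x = x ->
  exists2 m, (0 < m)%N & a (g ^+ m)%g y = y.
Proof.
move=> T_lf; have [p xp <-] := tree_connected (treeP T) x y.
elim: p g x xp => [|z p IHp] g x /=; first by move=> _ gx; exists 1.
move=> /andP[xz zp] gx.
have [|m [n [mn gE]]] := @finite_pigeonhole _ _ (fun n => a (g ^+ n)%g z) (T_lf x).
  by move=> n /=; rewrite -{1}(fix_expg n gx) act_adj.
have gz : a (g ^+ (n - m))%g z = z.
  by apply: (@act_inj (g ^+ m)%g); rewrite -actM -expgnDr subnKC // ltnW.
have [l l_gt0 lE] := IHp _ _ zp gz.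
exists ((n - m) * l)%N; first by rewrite muln_gt0 subn_gt0 mn.
by rewrite expgnA.
Qed.

End Actions.

(** * Restricting an action to an invariant subtree *)

Section Subtree.
Variables (T : tree) (S : set T).
Hypotheses (S_sub : subtree S) (S0 : S !=set0).

(** A boolean membership predicate makes [val] injective and equality of vertices decidable. *)
Let V := {x : T | `[< S x >]}.
Let V_adj : rel V := fun x y => adj (val x) (val y).

Let V_adj_sym : symmetric V_adj.
Proof. by move=> x y; exact: adj_sym. Qed.

Let V_adj_irr : irreflexive V_adj.
Proof. by move=> x; exact: adj_irr. Qed.

Definition sub_graph := Graph V_adj_sym V_adj_irr.

Lemma sub_graph_tree : is_tree sub_graph.
Proof.
split.
- by have [x /asboolP Sx] := S0; constructor; exact: (exist _ x Sx).
- move=> [x Sx] [y Sy].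
  have [p [xp lp pS]] := S_sub (asboolW Sx) (asboolW Sy).
  elim: p x Sx xp lp pS => [|z p IHp] x Sx /=.
    by move=> _ xy _; exists [::] => //; apply: val_inj.
  move=> /andP[xz zp] lp pS.
  have /asboolP Sz : S z by apply: pS; rewrite mem_head.
  have [|q zq lq] := IHp z Sz zp lp.
    by move=> u up; apply: pS; rewrite inE up orbT.
  by exists (exist _ z Sz :: q) => //=; rewrite zq andbT.
- move=> c /andP[c_cycle c_uniq].
  rewrite -(size_map val); apply: (tree_acyclic (treeP T)).
  apply/andP; split; last by rewrite map_inj_uniq //; exact: val_inj.
  case: c c_cycle {c_uniq} => //= x c.
  by rewrite -map_rcons (map_path (e' := V_adj) (b := pred0)) //; apply/hasPn.
Qed.

Definition sub_tree := Tree sub_graph_tree.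

Lemma sub_tree_locally_finite : locally_finite T -> locally_finite sub_tree.
Proof.
move=> T_lf x; apply: (@finite_preimage _ _ _ val _ (T_lf (val x))).
by move=> y z _ _; exact: val_inj.
Qed.

Variables (G : groupType) (a : tree_action G T).
Hypothesis S_act : forall g x, S x -> S (a g x).

Let V_act_subproof g (x : V) : `[< S (a g (val x)) >].
Proof. by case: x => x /= Sx; apply/asboolP; apply: S_act; apply: asboolW. Qed.

Let V_act g (x : V) : V := exist _ (a g (val x)) (V_act_subproof g x).

Let V_act1 x : V_act 1%g x = x.
Proof. by apply: val_inj; exact: act1. Qed.

Let V_actM g h x : V_act (g * h)%g x = V_act g (V_act h x).
Proof. by apply: val_inj; exact: actM. Qed.

Let V_act_adj g x y : V_adj (V_act g x) (V_act g y) = V_adj x y.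
Proof. exact: act_adj. Qed.

Definition sub_action : tree_action G sub_tree :=
  @TreeAction G sub_tree V_act V_act1 V_actM V_act_adj.

(** The image in [T] of an invariant subtree of [sub_tree] is again an invariant subtree, so it
    contains [core a] and hence [S]. *)
Lemma sub_action_minimal : S `<=` core a -> minimal_action sub_action.
Proof.
move=> SC [S' [S'_sub [x S'x] [_ nS'] /invariantP S'_act]]; apply: nS' => y _.
have : [set val z | z in S'] (val (y : V)).
  apply: (SC _ (asboolW (valP (y : V)))).
  - move=> _ _ [u S'u <-] [v S'v <-]; have [p [up <- pS']] := S'_sub _ _ S'u S'v.
    exists (map val p); split; last by move=> _ /mapP[z /pS' S'z ->]; exists z.
      by rewrite (map_path (e' := V_adj) (b := pred0)) //; apply/hasPn.
    by rewrite last_map.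
  - by exists (val (x : V)), x.
  - by apply/invariantP => g _ [z S'z <-]; exists (sub_action g z); [exact: S'_act|].
by case=> z S'z /val_inj <-.
Qed.

End Subtree.

(** If [f] moves both [x] and [y], the coordinates at [f x] and [f y] give [1 - t = t * (f x == y)]
    and [t = (1 - t) * (f y == x)]. As [t] and [1 - t] are not both zero, [f] swaps [x] and [y]. *)
Lemma elliptic_fix_sq (R : realType) (T : tree) (f : T -> T) :
  injective f -> elliptic R f -> exists x, f (f x) = x.
Proof.
move=> f_inj [x [y [t [xy _ fE]]]].
have := fE (f x); have := fE (f y); rewrite /segment_point !eqxx.
have [fxx|fxx] := eqVneq (f x) x; first by exists x; rewrite !fxx.
have [fyy|fyy] := eqVneq (f y) y; first by exists y; rewrite !fyy.
case: xy => [<-|xy].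
  rewrite (negPf fxx) eqxx !mulr1 !mulr0 addr0 subrK => /esym/eqP.
  by rewrite eq_sym oner_eq0.
have nxy : x != y by apply/eqP => xE; rewrite xE adj_irr in xy.
rewrite !(inj_eq f_inj) (negPf nxy) eq_sym (negPf nxy).
rewrite !mulr1 !mulr0 addr0 !add0r addr0.
have [fxy|fxy] := eqVneq (f x) y; have [fyx|fyx] := eqVneq (f y) x.
- by exists x; rewrite fxy.
all: by move=> /= t1 t2; exfalso; clear - t1 t2; lra.
Qed.

(** * Integer powers and copies of the free abelian group of rank two *)

Section IntegerPowers.
Variable G : groupType.
Implicit Types (g h : G) (m n : int).
Local Open Scope group_scope.

Definition expgz g m := match m with Posz p => g ^+ p | Negz p => g ^- p.+1 end.

Lemma expgz_sub g (p q : nat) : expgz g (p%:Z - q%:Z)%R = g ^+ p * g ^- q.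
Proof.
have [qp|/ltnW pq] := leqP q p; first by rewrite subzn //= expgnFr.
rewrite -opprB subzn // -[in RHS](subnK pq) expgnDr invgM mulVKg.
by case: (q - p)%N => [|r] /=; rewrite ?invg1.
Qed.

Lemma int_subn m : exists p q : nat, m = (p%:Z - q%:Z)%R.
Proof.
by case: m => p; [exists p, 0; rewrite subr0|exists 0, p.+1; rewrite sub0r NegzE].
Qed.

(** Writing both exponents as differences of naturals avoids a case analysis on signs. *)
Lemma expgzD g m n : expgz g (m + n)%R = expgz g m * expgz g n.
Proof.
have [p [q ->]] := int_subn m; have [r [s ->]] := int_subn n.
rewrite addrACA -opprD -!PoszD !expgz_sub !expgnDr invgM.
rewrite -!mulgA; congr (_ * _); rewrite mulgA.
by apply/commute_sym/commuteM; [apply/commute_sym|]; do ?apply: commuteV;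
  apply/commute_sym; do ?apply: commuteV; apply/commuteX2/commute_refl.
Qed.

Lemma commute_expgz g h m n : commute g h -> commute (expgz g m) (expgz h n).
Proof.
move=> gh; case: m => p; case: n => q /=; rewrite /commute;
  do ?[exact: commuteX2 | apply: commuteV | apply: commute_sym; apply: commuteV];
  by [exact: commuteX2 | apply: commute_sym; exact: commuteX2].
Qed.

Lemma expgz_eq1 g m : torsion_free G -> g <> 1 -> expgz g m = 1 -> m = 0%R.
Proof.
move=> tfG g1; case: m => [[//|p] gp|p /eqP]; first by case: g1; exact: tfG gp.
by rewrite /= invg_eq1 => /eqP gp; case: g1; exact: tfG gp.
Qed.

Lemma contains_ZxZ_commute g h : commute g h ->
  (forall m n, expgz g m * expgz h n = 1 -> m = 0%R /\ n = 0%R) ->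
  contains_ZxZ G.
Proof.
move=> gh free; pose f (u : int * int) := expgz g u.1 * expgz h u.2.
have fD u v : f (u + v)%R = f u * f v.
  rewrite /f !expgzD -!mulgA; congr (_ * _).
  by rewrite !mulgA; congr (_ * _); apply: commute_expgz.
exists f => // u v fuv.
have /free[u1 u2] : f (u - v)%R = 1.
  by apply: (@mulIg _ (f v)); rewrite -fD subrK mul1g.
case: u v u1 u2 {fuv} => [u1 u2] [v1 v2] /=.
by move=> /eqP; rewrite subr_eq0 => /eqP-> /eqP; rewrite subr_eq0 => /eqP->.
Qed.

End IntegerPowers.

Lemma fix_expgz (G : groupType) (T : tree) (a : tree_action G T) g x m :
  a g x = x -> a (expgz g m) x = x.
Proof. by case: m => p gx /=; [|apply: fix_invg]; apply: fix_expg. Qed.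

Lemma torsion_free_finite (G : groupType) (A : set G) (g : G) :
  torsion_free G -> finite_set A -> (forall n, A (g ^+ n)%g) -> g = 1%g.
Proof.
move=> tfG /finite_pigeonhole/[apply] -[m [n [mn gE]]].
apply: (tfG _ (n - m)%N); first by rewrite subn_gt0.
by rewrite expgnFr ?(ltnW mn) // gE mulgV.
Qed.

(** * Proper actions on subproducts *)

Section Product.
Variables (G : groupType) (k : nat) (T : 'I_k -> tree).
Variable a : forall i : 'I_k, tree_action G (T i).
Hypothesis tfG : torsion_free G.
Implicit Types (J : {set 'I_k}) (x : prod_vertex T) (g h : G).

(** Here [x] still ranges over the whole product, which avoids families indexed by [J]. *)
Definition proper_on J := forall x,
  finite_set [set g : G | forall i, i \in J -> a i g (x i) = x i].

Lemma proper_onT : proper_action a -> proper_on [set: 'I_k]%SET.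
Proof.
move=> a_proper x; apply: sub_finite_set (a_proper x) => g /= gx.
by apply: functional_extensionality_dep => i; apply: gx; rewrite inE.
Qed.

(** All powers of [g] lie in one finite stabiliser. *)
Lemma proper_on_fixed J x g : proper_on J ->
  (forall i, i \in J -> a i g (x i) = x i) -> g = 1%g.
Proof.
move=> /(_ x)/torsion_free_finite J_fin gx; apply: J_fin => // n i iJ.
exact/fix_expg/gx.
Qed.

Lemma proper_on_sq_free J g : proper_on J -> g <> 1%g ->
  exists2 i, i \in J & forall y, a i g (a i g y) <> y.
Proof.
move=> J_proper g1; apply: contrapT => gJ; apply: g1.
(* Outside [J] an arbitrary vertex serves as coordinate. *)
have /fin_all_exists[x xE] i : exists y, i \in J -> a i g (a i g y) = y.
  have [y0] := tree_inhabited (treeP (T i)); apply: contrapT => gi; apply: gJ.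
  exists i; first by apply: contrapT => iJ; apply: gi; exists y0.
  by move=> y gy; apply: gi; exists y.
apply: (tfG (isT : 0 < 2)%N); apply: (proper_on_fixed (x := x) J_proper) => i iJ.
by rewrite expg2 actM xE.
Qed.

(** If all these stabilisers were trivial, they would be finite. *)
Lemma not_proper_on_fixed J i : proper_on J -> ~ proper_on (J :\ i)%SET ->
  exists x h, h <> 1%g /\ forall j, j \in (J :\ i)%SET -> a j h (x j) = x j.
Proof.
move=> J_proper nJ; apply: contrapT => nh; apply: nJ => x.
apply: sub_finite_set (finite_set1 1%g) => h /= hx.
by apply: contrapT => h1; apply: nh; exists x, h.
Qed.

Hypothesis T_lf : forall i, locally_finite (T i).
Hypothesis noZxZ : ~ contains_ZxZ G.

(* The orbit of each [n x_j] under h is finite, so the commutator of n with a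
   suitable power of h fixes both x_j, for j <> i, and y: it is trivial. *)
Lemma fixator_trivial J i x h n (S : set (T i)) : proper_on J ->
  h <> 1%g -> (forall j, j \in (J :\ i)%SET -> a j h (x j) = x j) ->
  (forall g y, S y -> S (a i g y)) -> S !=set0 ->
  (forall y, S y -> a i n y = y) -> n = 1%g.
Proof.
move=> J_proper h1 hx S_act [y Sy] nS; apply: contrapT => n1; apply: noZxZ.
have /fin_all_exists[m mP] j : exists m, j \in (J :\ i)%SET ->
    (0 < m)%N /\ a j (h ^+ m)%g (a j n (x j)) = a j n (x j).
  have [jJ|/negP jJ] := boolP (j \in (J :\ i)%SET); last by exists 0.
  have [m m0 hm] := fix_expg_locally_finite (a j n (x j)) (T_lf (i := j)) (hx j jJ).
  by exists m.
(* The [i]-th coordinate of [x] is replaced by [y]; [M] is a common multiple of the exponents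
   [m j]. *)
pose x' := dfwith x y.
pose M := (\prod_(j in (J :\ i)%SET) m j)%N.
have M0 : (0 < M)%N by apply: prodn_cond_gt0 => j /mP[].
have hMx j : j \in (J :\ i)%SET -> a j (h ^+ M)%g (a j n (x j)) = a j n (x j).
  move=> jJ; have [_ hm] := mP j jJ.
  by rewrite /M (bigD1 j) //= expgnA; exact: fix_expg.
have fixed g : (forall j, j \in (J :\ i)%SET -> a j g (x j) = x j) ->
    a i g y = y -> g = 1%g.
  move=> gx gy; apply: (proper_on_fixed (x := x') J_proper) => j jJ.
  rewrite /x'; case: dfwithP jJ => [//|j' ij jJ].
  by apply: gx; rewrite !inE eq_sym ij.
have c : commute n (h ^+ M)%g.
  suff /mulg1_eq : (n^-1 * (h ^+ M * (n * h ^- M)) = 1)%g.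
    by rewrite invgK /commute => {1}->; rewrite -!mulgA mulVg mulg1.
  apply: fixed => [j jJ|].
    rewrite !actM (fix_invg (fix_expg M (hx j jJ))) hMx //.
    by apply/act_invP.
  rewrite !actM nS; last exact: S_act.
  by rewrite -[X in a i _ X](actM (a i)) mulgV act1; apply/fix_invg/nS.
apply: (contains_ZxZ_commute c) => p q pq.
(* This power fixes the [x j] as a power of [h], and fixes [y] as the inverse of a power of [n]. *)
have hq : expgz (h ^+ M)%g q = 1%g.
  apply: fixed => [j jJ|]; first by apply/fix_expgz/fix_expg/hx.
  by rewrite -(mulg1_eq pq); apply/fix_invg/fix_expgz/nS.
have q0 : q = 0%R.
  by apply: expgz_eq1 hq => // hM; apply: h1; exact: tfG hM.
split=> //; apply: (expgz_eq1 tfG n1).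
by move: pq; rewrite hq mulg1.
Qed.

End Product.

Theorem corollary7p2 (R : realType) (G : groupType) (k : nat)
    (T : 'I_k -> tree) (a : forall i : 'I_k, tree_action G (T i))
    (T_lf : forall i : 'I_k, locally_finite (T i))
    (G_torsion_free : torsion_free G)
    (a_proper : proper_action a)
    (G_noZxZ : ~ contains_ZxZ G) :
  forall g : G, g <> 1%g ->
    exists (U : tree) (b : tree_action G U),
      [/\ locally_finite U, minimal_action b, faithful_action b
        & hyperbolic R (b g)].
Proof.
move=> g g1.
have [|J /minsetP[/asboolP J_proper J_min]] :=
    ex_minset (P := fun J => `[< proper_on a J >]).
  by exists [set: 'I_k]%SET; apply/asboolP/proper_onT.
have [i iJ gi] := proper_on_sq_free G_torsion_free J_proper g1.
(* Properness on [J :\ i] would contradict the minimality of [J]. *)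
have [|x [h [h1 hx]]] := not_proper_on_fixed (i := i) J_proper.
  move=> /asboolP/J_min/(_ (subD1set _ _)) JE.
  by move: iJ; rewrite -JE !inE eqxx.
have C0 : core (a i) !=set0.
  by apply: (core_neq0 (g := g)) => y gy; apply: (gi y); rewrite !gy.
have C_sub := @core_subtree _ _ (a i); have C_act := @core_act _ _ (a i).
exists (sub_tree C_sub C0), (sub_action C_sub C0 C_act); split.
- exact/sub_tree_locally_finite/T_lf.
- exact: sub_action_minimal.
- move=> n nU.
  apply: (fixator_trivial G_torsion_free T_lf G_noZxZ J_proper h1 hx C_act C0).
  move=> y Cy; have /asboolP Cy' := Cy.
  by have /(congr1 val) := nU (exist _ y Cy').
(* If [g] were elliptic, its square would fix a vertex of the core, contrary to the choice of
   [i]. *)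
- move=> /elliptic_fix_sq[|y /(congr1 val)]; first exact: act_inj.
  exact: gi.
Qed.
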